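(* Let $\lambda=(\lambda_1,\dots,\lambda_l)$, $l\ge 2$, be a tuple of positive integers with $\lambda_1+\dots+\lambda_l=n$, and let $\lambda'=(\lambda_1,\dots,\lambda_{l-1})$, $|\lambda'|=n-\lambda_l$. Let $S=\{a_1,\dots,a_r\}$ be the set of eigenvalues of the Radon transform for $(GL_n(\mathbb{F}_q),(n-\lambda_l,\lambda_l))$ and let $S'=\{b_1,\dots,b_p\}$ be the set of eigenvalues of the Radon transform for $(GL_{|\lambda'|}(\mathbb{F}_q),\lambda')$. Then the set of eigenvalues of the Radon transform for $(GL_n(\mathbb{F}_q),\lambda)$ is a subset of $S\cdot S':=\{a_ib_j : 1\le i\le r,\ 1\le j\le p\}$.
   Context: $\mathbb{F}_q$ is a finite field. For a tuple $\mu=(\mu_1,\dots,\mu_l)$ of positive integers with sum $m$: $U_\mu\subset GL_m(\mathbb{F}_q)$ is the subgroup of block upper triangular matrices with diagonal blocks equal to identity matrices of sizes $\mu_1,\dots,\mu_l$, and $U_\mu^{op}$ is the subgroup of transposes of elements of $U_\mu$. For a subgroup $H$ of a finite group $G$, $e_H=\frac{1}{|H|}\sum_{h\in H}h\in\mathbb{C}[G]$, and $\mathbb{C}[G/H]=\mathbb{C}[G]e_H$ is the space of right $H$-invariant elements of $\mathbb{C}[G]$. The Radon transform for $(GL_m(\mathbb{F}_q),\mu)$ is the linear operator on $\mathbb{C}[GL_m(\mathbb{F}_q)/U_\mu]$ given by right multiplication by $\mathcal{R}=|U_\mu|^2e_{U_\mu}e_{U_\mu^{op}}e_{U_\mu}$.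 In terms of right $U_\mu$-invariant functions on $GL_m(\mathbb{F}_q)$ it is $f\mapsto\big(x\mapsto\sum_{u\in U_\mu}\sum_{\bar u\in U_\mu^{op}}f(xu\bar u)\big)$. *)

(* Defs.v *)
From HB Require Import structures.
From mathcomp Require Import all_boot all_order all_fingroup all_algebra.

Set Implicit Arguments.
Unset Strict Implicit.
Unset Printing Implicit Defensive.

Import GRing.Theory Num.Theory.
Local Open Scope ring_scope.

(* The group algebra C[G] of a finite group: the function a stands for the     *)
(* formal combination \sum_g a g * g.                                          *)
Notation group_algebra C gT := {ffun FinGroup.sort gT -> C^o}.

Section GroupAlgebra.

Variables (C : numFieldType) (gT : finGroupType).
Local Notation A := (group_algebra C gT).
Implicit Types (a b c : A) (H K : {group gT}) (S : {set gT}).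

Definition gconv a b : A :=
  [ffun x => \sum_(y : gT) (a y : C) * (b (y^-1 * x)%g : C)].

Definition gconvr b a : A := gconv a b.

Lemma gconvr_is_linear b : linear (gconvr b).
Proof.
move=> k a a'; apply/ffunP=> x; rewrite !ffunE.
transitivity (k * (\sum_y (a y : C) * (b (y^-1 * x)%g : C))
              + \sum_y (a' y : C) * (b (y^-1 * x)%g : C)) => //.
rewrite mulr_sumr -big_split /=; apply: eq_bigr => y _; rewrite !ffunE.
by rewrite mulrA; exact: mulrDl.
Qed.

HB.instance Definition _ b :=
  GRing.isSemilinear.Build C A A *:%R (gconvr b)
    (GRing.semilinear_linear (gconvr_is_linear b)).

Lemma gconvZr (k : C) a b : gconv a (k *: b) = k *: gconv a b.
Proof.
apply/ffunP=> x; rewrite !ffunE.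
transitivity (k * (\sum_y (a y : C) * (b (y^-1 * x)%g : C))) => //.
rewrite mulr_sumr; apply: eq_bigr => y _; rewrite !ffunE.
exact: mulrCA.
Qed.

Lemma gconvA a b c : gconv a (gconv b c) = gconv (gconv a b) c.
Proof.
apply/ffunP=> x; rewrite !ffunE.
under eq_bigr => y _ do rewrite ffunE mulr_sumr.
under [RHS]eq_bigr => y _ do rewrite ffunE mulr_suml.
rewrite [RHS]exchange_big /=; apply: eq_bigr => y _.
rewrite [RHS](reindex_inj (mulgI y)) /=; apply: eq_bigr => z _.
by rewrite mulrA mulKg invMg -mulgA.
Qed.

(* e_S = 1/|S| \sum_(s in S) s *)
Definition gidem S : A := [ffun x => (x \in S)%:R / #|S|%:R : C].

Lemma natr_avg (n : nat) (k : C) : n%:R != 0 :> C -> n%:R^-1 * (k *+ n) = k.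
Proof. by move=> n0; rewrite -[k *+ n]mulr_natl mulKf. Qed.

Lemma gconv_gidemE a H x :
  gconv a (gidem H) x = #|H|%:R^-1 * \sum_(h in H) a (x * h)%g :> C.
Proof.
rewrite ffunE (reindex_inj (mulgI x)) mulr_sumr [RHS]big_mkcond /=.
apply: eq_bigr => h _; rewrite ffunE invMg mulgKV groupV.
by case: ifP => _; rewrite ?mul0r ?mulr0 // mul1r mulrC.
Qed.

Lemma gidemK H : gconv (gidem H) (gidem H) = gidem H.
Proof.
apply/ffunP=> x; rewrite gconv_gidemE ffunE.
have n0 : #|H|%:R != 0 :> C by rewrite pnatr_eq0 -lt0n cardG_gt0.
rewrite (eq_bigr (fun=> (x \in H)%:R / #|H|%:R)) => [|h hH]; last first.
  by rewrite ffunE groupMr.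
by rewrite sumr_const; exact: natr_avg.
Qed.

(* C[G/H] = C[G] e_H *)
Definition right_inv_space S : {vspace A} := limg (linfun (gconvr (gidem S))).

Lemma right_inv_spaceP H a :
  reflect (forall x h, h \in H -> a (x * h)%g = a x) (a \in right_inv_space H).
Proof.
have n0 : #|H|%:R != 0 :> C by rewrite pnatr_eq0 -lt0n cardG_gt0.
apply: (iffP memv_imgP) => [[b _ ->] x h hH | aH].
  rewrite lfunE /= /gconvr !gconv_gidemE; congr (_ * _).
  rewrite [RHS](reindex_inj (mulgI h)) /=.
  by apply: eq_big => [k | k _]; rewrite ?groupMl // mulgA.
exists a; first exact: memvf.
apply/ffunP=> x; rewrite lfunE /= /gconvr gconv_gidemE.
rewrite (eq_bigr (fun=> a x)) => [|h /aH-> //].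
by rewrite sumr_const natr_avg.
Qed.

Definition radon_element S S' : A :=
  (#|S| ^ 2)%:R *: gconv (gconv (gidem S) (gidem S')) (gidem S).

Definition radon_of S S' : 'End(subvs_of (right_inv_space S)) :=
  (linfun (vsproj (right_inv_space S)) \o
     linfun (gconvr (radon_element S S')) \o linfun vsval)%VF.

(* The projection in radon_of plays no role, since C[G/H] is stable under      *)
(* right multiplication by the Radon element.                                  *)
Lemma radon_ofE H K f :
  vsval (radon_of H K f) = gconv (vsval f) (radon_element H K).
Proof.
rewrite /radon_of !comp_lfunE !lfunE /= vsprojK //.
apply/memv_imgP.
pose c : A := (#|H| ^ 2)%:R *: gconv (gconv (vsval f) (gidem H)) (gidem K).
exists c; rewrite ?memvf // lfunE /= linearZ /= /gconvr.
by rewrite /radon_element gconvZr !gconvA.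
Qed.

Lemma radon_ofE_fun H K f x : #|K| = #|H| ->
  vsval (radon_of H K f) x =
    \sum_(u in H) \sum_(v in K) vsval f (x * u * v)%g.
Proof.
move=> cKH; rewrite radon_ofE /radon_element gconvZr !gconvA ffunE.
have n0 : #|H|%:R != 0 :> C by rewrite pnatr_eq0 -lt0n cardG_gt0.
have fH : gconv (vsval f) (gidem H) = vsval f.
  apply/ffunP=> y; rewrite gconv_gidemE.
  rewrite (eq_bigr (fun=> vsval f y)) => [|h hH].
    by rewrite sumr_const; exact: natr_avg.
  exact: (right_inv_spaceP _ _ (subvsP f)).
rewrite fH gconv_gidemE.
under eq_bigr => u _ do rewrite gconv_gidemE cKH.
rewrite -mulr_sumr; set t := (X in _ *: (_ * (_ * X))).
transitivity ((#|H| ^ 2)%:R * (#|H|%:R^-1 * (#|H|%:R^-1 * (t : C)))) => //.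
by rewrite natrX -!mulrA !mulVKf // expr2 -!mulrA !mulVKf.
Qed.

Lemma radon_eigenvalueP H K (k : C) :
  reflect (exists f, [/\ f \in right_inv_space H, f != 0
                       & gconv f (radon_element H K) = k *: f])
          (passmx.leigenvalue (radon_of H K) k).
Proof.
have kerE g : (g \in passmx.leigenspace (radon_of H K) k)
    = (gconv (vsval g) (radon_element H K) == k *: vsval g).
  rewrite memv_ker add_lfunE opp_lfunE scale_lfunE id_lfunE subr_eq0.
  by rewrite -(inj_eq val_inj) /= radon_ofE.
rewrite /passmx.leigenvalue; apply: (iffP idP) => [nz | [f [fH f0 fE]]].
  exists (vsval (vpick (passmx.leigenspace (radon_of H K) k))); split.
  - exact: subvsP.
  - rewrite -[0]/(vsval (0 : subvs_of (right_inv_space H))).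
    by rewrite (inj_eq val_inj) vpick0.
  by apply/eqP; rewrite -kerE memv_pick.
apply: contraNneq f0 => ker0.
have : vsproj (right_inv_space H) f \in passmx.leigenspace (radon_of H K) k.
  by rewrite kerE vsprojK // fE.
by rewrite ker0 memv0 -(inj_eq val_inj) /= vsprojK.
Qed.

End GroupAlgebra.

Arguments gidem {C gT} S.
Arguments right_inv_space C {gT} S.
Arguments radon_element C {gT} S S'.
Arguments radon_of C {gT} S S'.

Section BlockUnipotent.

Variables (F : finFieldType) (m : nat).
Implicit Types (mu : seq nat) (u v : {'GL_m[F]}).

(* The size of the matrices in {'GL_m[F]} is m.-1.+1, which is m as soon as m  *)
(* is positive. When m = sumn mu, reshape_index mu i is the (0-based) number   *)
(* of the block of mu containing the row or column i.                          *)
Definition U_set mu : {set {'GL_m[F]}} :=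
  [set u | [forall i : 'I_m.-1.+1, forall j : 'I_m.-1.+1,
     (reshape_index mu j <= reshape_index mu i)%N
       ==> (GLval u i j == (i == j)%:R)]].

Definition Uop_set mu : {set {'GL_m[F]}} :=
  [set v | [exists u in U_set mu, GLval v == (GLval u)^T]].

Lemma U_setP mu u :
  reflect (forall i j : 'I_m.-1.+1,
             (reshape_index mu j <= reshape_index mu i)%N ->
             GLval u i j = (i == j)%:R)
          (u \in U_set mu).
Proof.
rewrite inE; apply: (iffP forallP) => [uU i j ij | uU i].
  by have /forallP/(_ j)/implyP/(_ ij)/eqP := uU i.
by apply/forallP=> j; apply/implyP=> ij; apply/eqP/uU.
Qed.

Lemma U_group_set mu : group_set (U_set mu).
Proof.
apply/group_setP; split=> [|u v /U_setP uU /U_setP vU].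
  by apply/U_setP=> i j _; rewrite GL_1E mxE.
apply/U_setP=> i j ij; rewrite GL_MxE mxE.
rewrite -(vU i j ij) (bigD1 i) //= uU // eqxx mul1r big1 ?addr0 // => k ki.
case: (leqP (reshape_index mu k) (reshape_index mu i)) => [le_ki | lt_ik].
  by rewrite uU // eq_sym (negPf ki) mul0r.
rewrite vU ?(leq_trans ij (ltnW lt_ik)) //.
case: eqP lt_ik => [-> | _ _]; last by rewrite mulr0.
by rewrite ltnNge ij.
Qed.

Canonical U_group mu := Group (U_group_set mu).

Lemma Uop_setP mu v :
  reflect (exists2 u, u \in U_set mu & GLval v = (GLval u)^T)
          (v \in Uop_set mu).
Proof.
rewrite inE; apply: (iffP existsP) => [[u /andP[uU /eqP]] | [u uU /eqP vu]].
  by exists u.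
by exists u; rewrite uU.
Qed.

Lemma Uop_group_set mu : group_set (Uop_set mu).
Proof.
apply/group_setP; split=> [|v v' /Uop_setP[u uU vu] /Uop_setP[u' uU' vu']].
  by apply/Uop_setP; exists 1%g; rewrite ?group1 // GL_1E trmx1.
apply/Uop_setP; exists (u' * u)%g; first exact: groupM.
by rewrite !GL_MxE trmx_mul vu vu'.
Qed.

Canonical Uop_group mu := Group (Uop_group_set mu).

Lemma card_Uop mu : #|Uop_set mu| = #|U_set mu|.
Proof.
have trU (u : {'GL_m[F]}) : (GLval u)^T \is a GRing.unit.
  by rewrite -[_ \is a _]/(_ \in unitmx) unitmx_tr GL_unitmx.
pose tr u : {'GL_m[F]} := FinRing.unit _ (trU u).
have trI : injective tr.
  by move=> u v /(congr1 val) /= /(can_inj (@trmxK _ _ _)) /val_inj.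
rewrite -(card_imset (mem (U_set mu)) trI); apply: eq_card => v.
apply/Uop_setP/imsetP => [[u uU vu] | [u uU ->]]; exists u => //.
exact: val_inj.
Qed.

End BlockUnipotent.

(* The Radon transform for (GL_m(F), mu); meaningful when sumn mu = m > 0.     *)
Definition radon (C : numFieldType) (F : finFieldType) (m : nat)
    (mu : seq nat) :
    'End(subvs_of (right_inv_space C (U_set F m mu))) :=
  radon_of C (U_set F m mu) (Uop_set F m mu).

(* The Radon transform as an operator on right U-invariant functions. *)
Lemma radonE_fun (C : numFieldType) (F : finFieldType) (m : nat)
    (mu : seq nat) (f : subvs_of (right_inv_space C (U_set F m mu)))
    (x : {'GL_m[F]}) :
  vsval (radon C F m mu f) x =
    \sum_(u in U_set F m mu) \sum_(v in Uop_set F m mu) vsval f (x * u * v)%g.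
Proof. exact/radon_ofE_fun/card_Uop. Qed.

Definition radon_eigenvalues (C : numFieldType) (F : finFieldType) (m : nat)
    (mu : seq nat) : {pred C} :=
  [pred c | passmx.leigenvalue (radon C F m mu) c].

Arguments radon_eigenvalues C F m mu : clear implicits.

(* Main.v *)
Require Import Defs.
From mathcomp Require Import all_boot all_order all_fingroup all_algebra.
From mathcomp Require Import reals complex.

Set Implicit Arguments.
Unset Strict Implicit.
Unset Printing Implicit Defensive.

Import GRing.Theory Num.Theory passmx.
Local Open Scope ring_scope.

(** Write m = n - lambda_l, and let N be the unipotent radical U_(m, lambda_l)
    of GL_n, M its opposite, and L = GL_m the subgroup of the matrices
    diag(g, 1).  Put U' = U_lambda' and let U'op be its opposite, both viewed
    inside L.  Then U_lambda = N U' and U_lambda^op = M U'op, with N and U'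
    meeting trivially, and L normalizes both N and M.  If a subgroup K
    normalizes H, the idempotents e_H and e_K commute and e_H e_K = e_(HK)
    ([gidem_mul], [gcomm_gidem]), so the idempotents of U' and U'op commute
    with those of N and M, and the Radon element factors:

      |U|^2 e_U e_Uop e_U = (|N|^2 e_N e_M e_N) (|U'|^2 e_U' e_U'op e_U').

    Call the two factors A and B.  They commute with each other and with e_U,
    so right multiplication by either one preserves the c-eigenspace of AB in
    C[G]e_U.  Over an algebraically closed field this eigenspace, if nonzero,
    contains a common eigenvector v of A and B, with eigenvalues a and b, and
    necessarily c = ab ([radon_of_leigenvalue_mul]).

    As v is invariant under N, a is an eigenvalue of the Radon transform for
    (n - lambda_l, lambda_l).  For b, multiplication by B only mixes the values
    of v inside a coset xL; restricting v to a coset where it does not vanish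
    gives an eigenfunction on GL_m for lambda'
    ([radon_of_leigenvalue_morphim]). *)

(** * Common eigenvectors in an invariant subspace *)

Section CommonEigenvector.

Variables (C : numClosedFieldType) (vT : vectType C) (W : {vspace vT}).

Definition restrict_end (f : 'End(vT)) : 'End(subvs_of W) :=
  (linfun (vsproj W) \o f \o linfun vsval)%VF.

Lemma restrict_endE f : (f @: W <= W)%VS ->
  forall w, vsval (restrict_end f w) = f (vsval w).
Proof.
move=> fW w; rewrite !comp_lfunE !lfunE /= vsprojK //.
exact: (subvP fW) (memv_img _ (subvsP w)).
Qed.

(** The matrices of f and g restricted to W commute, hence have a common
    eigenvector. *)
Lemma common_eigenvector_vspace (f g : 'End(vT)) :
    W != 0%VS -> (f @: W <= W)%VS -> (g @: W <= W)%VS ->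
    {in W, forall v, f (g v) = g (f v)} ->
  exists v a b, [/\ v \in W, v != 0, f v = a *: v & g v = b *: v].
Proof.
move=> W0 fW gW fgC.
pose e := vbasis {:subvs_of W}.
have eB : basis_of {:subvs_of W} e := vbasisP _.
pose mx h := mxof e e (restrict_end h).
have dimW : (0 < \dim {:subvs_of W})%N by rewrite dimvf /dim /= lt0n dimv_eq0.
have mxC : mx f *m mx g = mx g *m mx f.
  rewrite -!(mxof_comp _ _ eB); congr mxof; apply/lfunP=> w.
  rewrite [LHS]comp_lfunE [RHS]comp_lfunE; apply: val_inj.
  by rewrite [LHS]restrict_endE // [RHS]restrict_endE // !restrict_endE // fgC
             ?subvsP.
have [u u0 /andP[/sub_rVP[a fu] /sub_rVP[b gu]]] :=
  common_eigenvector2 dimW mxC.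
pose w := vecof e u.
have mxE h c : (h @: W <= W)%VS -> u *m mx h = c *: u ->
    h (vsval w) = c *: vsval w.
  move=> hW hu; rewrite -restrict_endE //.
  by rewrite (hom_vecof _ eB) hu !linearZ.
exists (vsval w), a, b; split; [exact: subvsP | | exact: mxE | exact: mxE].
rewrite -[0]/(vsval (0 : subvs_of W)) (inj_eq val_inj).
by rewrite vecof_eq0.
Qed.

End CommonEigenvector.

(** * Idempotents of subgroups in the group algebra *)

Section Convolution.

Variables (C : numFieldType) (gT : finGroupType).
Implicit Types (a b c : group_algebra C gT) (H K : {group gT}).
Local Notation "a ** b" := (gconv a b) (at level 40, left associativity).

Definition gcomm a b := a ** b = b ** a.

Lemma gconvZl (k : C) a b : (k *: a) ** b = k *: (a ** b).
Proof. by rewrite -/(gconvr b (k *: a)) linearZ. Qed.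

Lemma gcomm_sym a b : gcomm a b -> gcomm b a. Proof. by []. Qed.

Lemma gcommM a b c : gcomm a b -> gcomm a c -> gcomm a (b ** c).
Proof. by rewrite /gcomm => ab ac; rewrite gconvA ab -gconvA ac gconvA. Qed.

Lemma gcommZ (k : C) a b : gcomm a b -> gcomm a (k *: b).
Proof. by rewrite /gcomm gconvZr gconvZl => ->. Qed.

(** Each element of HK is a product hk in exactly |H :&: K| ways, so the
    product of the two averages is uniform on HK. *)
Lemma gidem_mul H K :
  gidem H ** gidem K = gidem (H * K)%g :> group_algebra C gT.
Proof.
have c0 (L : {group gT}) : #|L|%:R != 0 :> C.
  by rewrite pnatr_eq0 -lt0n cardG_gt0.
apply/ffunP=> x; rewrite gconv_gidemE ffunE.
under eq_bigr => y _ do rewrite ffunE.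
case: (boolP (x \in _)) => [/mulsgP[h k0 hH k0K ->] | /mulsgP xHK]; last first.
  rewrite mul0r big1 ?mulr0 // => y yK; case: (boolP (_ \in H)) => [xyH|_].
    by case: xHK; exists (x * y)%g (y^-1)%g; rewrite ?groupV ?mulgK.
  exact: mul0r.
rewrite (reindex_inj (mulgI k0^-1%g)) /=.
under eq_bigl => y do rewrite groupMl ?groupV //.
under eq_bigr => y _ do rewrite mulgA mulgK groupMl //.
rewrite -mulr_suml -natr_sum mul1r.
have -> : (\sum_(y in K) (y \in H) = #|H :&: K|)%N.
  rewrite -sum1_card big_mkcond [RHS]big_mkcond; apply: eq_bigr => y _.
  by rewrite inE andbC; case: (y \in K); case: (y \in H).
have HK0 : #|(H * K)%g|%:R != 0 :> C.
  rewrite pnatr_eq0 -lt0n; apply/card_gt0P.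
  by exists (1 * 1)%g; rewrite mem_mulg.
have card_eq :
    #|H|%:R * #|K|%:R = #|(H * K)%g|%:R * #|H :&: K|%:R :> C.
  by rewrite -!natrM mul_cardG.
apply: (mulfI HK0); rewrite mulfV // mulrCA mulrA [_ * #|_|%:R]mulrC mulrACA.
by rewrite -card_eq -mulrA mulVKf // mulfV.
Qed.

Lemma gcomm_gidem H K : K \subset 'N(H)%g -> gcomm (gidem H) (gidem K).
Proof. by move=> nHK; rewrite /gcomm !gidem_mul (normC nHK). Qed.

Lemma right_inv_spaceE H a :
  (a \in right_inv_space C H) = (a ** gidem H == a).
Proof.
apply/idP/eqP => [/memv_imgP[b _ ->] | <-]; last first.
  by apply/memv_imgP; exists a; rewrite ?memvf // lfunE.
by rewrite lfunE /= /gconvr -gconvA gidemK.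
Qed.

Lemma right_inv_spaceS H K :
  K \subset H -> (right_inv_space C H <= right_inv_space C K)%VS.
Proof.
move=> /subsetP sKH; apply/subvP=> a /right_inv_spaceP aH.
by apply/right_inv_spaceP=> x h /sKH; exact: aH.
Qed.

Lemma right_inv_space_stable H a b :
    gcomm b (gidem H) -> a \in right_inv_space C H ->
  a ** b \in right_inv_space C H.
Proof.
rewrite !right_inv_spaceE => bH /eqP aH.
by rewrite -gconvA bH gconvA aH.
Qed.

(** * Factorization of the Radon element *)

Lemma gcomm_radon a H K :
    gcomm a (gidem H) -> gcomm a (gidem K) -> gcomm a (radon_element C H K).
Proof. by move=> aH aK; apply/gcommZ/gcommM => //; apply: gcommM. Qed.

Lemma gcomm_radon_gidem H K : gcomm (radon_element C H K) (gidem H).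
Proof.
by rewrite /gcomm /radon_element gconvZr gconvZl !gconvA gidemK -!gconvA gidemK.
Qed.

Section Factorization.

Variables N M K K' : {group gT}.
Hypotheses (nNK : K \subset 'N(N)%g) (nMK : K \subset 'N(M)%g).
Hypotheses (nNK' : K' \subset 'N(N)%g) (nMK' : K' \subset 'N(M)%g).

Lemma radon_element_comm :
  gcomm (radon_element C N M) (radon_element C K K').
Proof.
by apply: gcomm_radon; apply: gcomm_sym; apply: gcomm_radon;
   apply: gcomm_sym; apply: gcomm_gidem.
Qed.

(** The idempotents of K and K' move to the right of those of N and M; the
    cardinality condition matches the scalar |NK|^2 with |N|^2 |K|^2. *)
Lemma radon_element_mul :
    #|(N * K)%g| = (#|N| * #|K|)%N ->
  radon_element C (N * K)%g (M * K')%g =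
    radon_element C N M ** radon_element C K K'.
Proof.
move=> cNK.
rewrite /radon_element gconvZr gconvZl scalerA -natrM cNK expnMn mulnC.
congr (_ *: _); rewrite -!gidem_mul.
have NMN_K : gcomm (gidem N ** gidem M ** gidem N) (gidem K).
  by apply: gcomm_sym; do 2?apply: gcommM; apply: gcomm_sym; apply: gcomm_gidem.
(* The words become e_K e_N e_M e_K' e_N e_K and e_K e_N e_M e_N e_K' e_K, which
   differ by an exchange of e_K' and e_N. *)
rewrite {1}(gcomm_gidem nNK) !gconvA NMN_K !gconvA; congr (_ ** _).
by rewrite -gconvA -(gcomm_gidem nNK') gconvA.
Qed.

End Factorization.

End Convolution.

Section RadonEigenvalues.

Variables (C : numClosedFieldType) (gT : finGroupType).
Variables U U' N M K K' : {group gT}.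
Hypotheses (nNK : K \subset 'N(N)%g) (nMK : K \subset 'N(M)%g).
Hypotheses (nNK' : K' \subset 'N(N)%g) (nMK' : K' \subset 'N(M)%g).
Hypotheses (defU : (N * K = U)%g) (defU' : (M * K' = U')%g).
Hypothesis tiNK : (N :&: K = 1)%g.
Local Notation "a ** b" := (gconv a b) (at level 40, left associativity).

(** The two factors of the Radon element have a common eigenvector in each
    eigenspace of their product; it is invariant under U, hence under both
    N and K. *)
Lemma radon_of_leigenvalue_mul (c : C) :
    leigenvalue (radon_of C U U') c ->
  exists a b, [/\ leigenvalue (radon_of C N M) a,
                  leigenvalue (radon_of C K K') b & c = a * b].
Proof.
set A := radon_element C N M; set B := radon_element C K K'.
have AB : radon_element C U U' = A ** B.
  by rewrite -defU -defU' radon_element_mul // TI_cardMg.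
have BA : gcomm A B by exact: radon_element_comm.
have AU : gcomm A (gidem U).
  rewrite -defU -gidem_mul; apply: gcommM; first exact: gcomm_radon_gidem.
  apply: gcomm_sym; apply: gcomm_radon;
    by apply: gcomm_sym; apply: gcomm_gidem.
have BU : gcomm B (gidem U).
  rewrite -defU -gidem_mul; apply: gcommM; last exact: gcomm_radon_gidem.
  by apply: gcomm_sym; apply: gcomm_radon; apply: gcomm_gidem.
case/radon_eigenvalueP => f [fU f0 fc].
pose rho b : 'End(group_algebra C gT) := linfun (gconvr b).
have rhoE b a : rho b a = a ** b by rewrite lfunE.
pose W := (right_inv_space C U :&: leigenspace (rho (A ** B)) c)%VS.
have WP a :
    (a \in W) = (a \in right_inv_space C U) && (a ** (A ** B) == c *: a).
  rewrite memv_cap memv_ker add_lfunE opp_lfunE scale_lfunE id_lfunE rhoE.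
  by rewrite subr_eq0.
have W0 : W != 0%VS.
  by apply: contraNneq f0 => W0; rewrite -memv0 -W0 WP fU -AB fc /=.
have stab b : gcomm b (gidem U) -> gcomm b (A ** B) -> (rho b @: W <= W)%VS.
  move=> bU bAB; apply/subvP=> _ /memv_imgP[a + ->].
  rewrite rhoE !WP => /andP[aU /eqP aAB].
  by rewrite right_inv_space_stable //= -gconvA bAB gconvA aAB gconvZl.
have [||v _|v [a [b [vW v0 va vb]]]] :=
  @common_eigenvector_vspace _ _ W (rho A) (rho B) W0.
- by apply: stab => //; apply: gcommM.
- by apply: stab => //; apply: gcommM => //; apply: gcomm_sym.
- by rewrite !rhoE -!gconvA BA.
move: va vb vW; rewrite !rhoE WP => va vb /andP[vU /eqP vc].
have sNU : N \subset U by rewrite -defU mulG_subl.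
have sKU : K \subset U by rewrite -defU mulG_subr.
exists a, b; split.
- apply/radon_eigenvalueP; exists v; split=> //.
  exact: subvP (right_inv_spaceS _ sNU) _ vU.
- apply/radon_eigenvalueP; exists v; split=> //.
  exact: subvP (right_inv_spaceS _ sKU) _ vU.
move: vc; rewrite gconvA va gconvZl vb scalerA => /eqP.
rewrite -subr_eq0 -scalerBl scaler_eq0 (negPf v0) orbF subr_eq0.
by move/eqP.
Qed.

End RadonEigenvalues.

(** * Eigenvalues along an injective morphism *)

Section Transfer.

Variables (C : numFieldType) (rT gT : finGroupType).
Variable phi : {morphism [set: rT] >-> gT}.
Hypothesis injphi : ('injm phi)%g.
Local Notation "a ** b" := (gconv a b) (at level 40, left associativity).

Definition pull_coset x (f : group_algebra C gT) : group_algebra C rT :=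
  [ffun y => f (x * phi y)%g].

Lemma pull_coset_gidem x f (H : {group rT}) :
  pull_coset x (f ** gidem (phi @* H)%g) = pull_coset x f ** gidem H.
Proof.
apply/ffunP=> y; rewrite ffunE !gconv_gidemE card_injm ?subsetT //.
rewrite /= morphimEsub ?subsetT // big_imset /=; last first.
  by move=> h k _ _; apply: (injmP injphi); rewrite inE.
by congr (_ * _); apply: eq_bigr => h _; rewrite ffunE morphM ?inE // mulgA.
Qed.

(** An eigenfunction on the large group restricts to an eigenfunction on each
    coset of the image of phi, and is nonzero on at least one of them. *)
Lemma radon_of_leigenvalue_morphim (H K : {group rT}) (c : C) :
  leigenvalue (radon_of C (phi @* H)%g (phi @* K)%g) c ->
  leigenvalue (radon_of C H K) c.
Proof.
case/radon_eigenvalueP=> f [fH f0 fc].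
have [x fx0] : exists x, f x != 0.
  apply/existsP; apply: contraNT f0; rewrite negb_exists => /forallP f0.
  by apply/eqP/ffunP=> x; rewrite ffunE; apply/eqP; rewrite -[_ == _]negbK.
have pullZ k (g : group_algebra C gT) :
    pull_coset x (k *: g) = k *: pull_coset x g.
  by apply/ffunP=> y; rewrite !ffunE.
apply/radon_eigenvalueP; exists (pull_coset x f); split.
- move: fH; rewrite !right_inv_spaceE -pull_coset_gidem => /eqP fH.
  by rewrite fH.
- apply: contraNneq fx0 => /ffunP/(_ 1%g).
  by rewrite !ffunE morph1 mulg1 => ->.
rewrite -pullZ -fc /radon_element !gconvZr !gconvA pullZ card_injm ?subsetT //.
by rewrite !pull_coset_gidem.
Qed.

End Transfer.

(** * Block unipotent subgroups and the Levi subgroup *)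

Lemma reshape_index_rcons sh n i : (i < sumn sh + n)%N ->
  reshape_index (rcons sh n) i =
    if (i < sumn sh)%N then reshape_index sh i else size sh.
Proof.
rewrite /reshape_index; elim: sh => [|s sh IHsh] /= in i *.
  by rewrite subn_eq0 add0n => ->.
rewrite subn_eq0 -addnA; have [i_lt_s | le_s_i] := ltnP i s.
  by move=> _; rewrite ltn_addr.
rewrite -(subnKC le_s_i) !ltn_add2l -addnS addKn.
by move=> /IHsh->; case: ifP.
Qed.

Section GLTranspose.

Variables (F : finFieldType) (m : nat).
Implicit Types u v : {'GL_m[F]}.

Lemma trmx_GL_unit u : (GLval u)^T \is a GRing.unit.
Proof. by rewrite -[_ \is a _]/(_ \in unitmx) unitmx_tr GL_unitmx. Qed.

Definition GLtr u : {'GL_m[F]} := FinRing.unit _ (trmx_GL_unit u).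

Lemma GLtrK : involutive GLtr.
Proof. by move=> u; apply: val_inj; rewrite /= trmxK. Qed.

Lemma GLtrM u v : GLtr (u * v)%g = (GLtr v * GLtr u)%g.
Proof. by apply: val_inj; rewrite /= trmx_mul. Qed.

Lemma GLtr1 : GLtr 1%g = 1%g.
Proof. by apply: val_inj; rewrite /= trmx1. Qed.

Lemma GLtrV u : GLtr u^-1%g = (GLtr u)^-1%g.
Proof. by apply/(mulgI (GLtr u)); rewrite -GLtrM mulVg mulgV GLtr1. Qed.

Lemma GLtrJ u v : GLtr (u ^ v)%g = (GLtr u ^ GLtr v^-1)%g.
Proof. by rewrite !conjgE !GLtrM !GLtrV invgK mulgA. Qed.

Lemma Uop_setE mu : Uop_set F m mu = GLtr @: U_set F m mu.
Proof.
apply/setP=> v; apply/Uop_setP/imsetP => [[u uU vu] | [u uU ->]]; exists u => //.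
exact: val_inj.
Qed.

End GLTranspose.

Section Levi.

Variables (F : finFieldType) (p k : nat).
(* A successor size makes {'GL_m[F]} and {'GL_(m + k)[F]} consist of matrices of
   the expected sizes up to conversion, so that no casts are needed. *)
Local Notation m := p.+1.
Local Notation GLm := {'GL_m[F]}.
Local Notation GLn := {'GL_(m + k)[F]}.
Local Notation Nk := (U_group F (m + k) [:: m; k]).
Local Notation Nop := (Uop_group F (m + k) [:: m; k]).

(** The coercion GLval with its result at the block size m + k. *)
Definition GLn_mx (u : GLn) : 'M[F]_(m + k) := GLval u.

Lemma GLn_mx_inj : injective GLn_mx. Proof. exact: val_inj. Qed.

Definition levi_mx (g : 'M[F]_m) : 'M[F]_(m + k) := block_mx g 0 0 1%:M.

Lemma levi_unit (g : GLm) :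
  (levi_mx (GLval g) : 'M[F]_((m + k).-1.+1)) \is a GRing.unit.
Proof.
rewrite -[_ \is a _]/(levi_mx (GLval g) \in unitmx) unitmxE.
by rewrite det_ublock det1 mulr1 -unitmxE (GL_unitmx g).
Qed.

Definition levi (g : GLm) : GLn := FinRing.unit _ (levi_unit g).

Lemma leviM : {in setT &, {morph levi : g h / (g * h)%g}}.
Proof.
move=> g h _ _; apply: GLn_mx_inj.
rewrite -[RHS]/(levi_mx (GLval g) *m levi_mx (GLval h)) mulmx_block.
by rewrite !(mul0mx, mulmx0, addr0, add0r, mul1mx).
Qed.

Canonical levi_morphism := Morphism leviM.

Lemma leviV g : levi g^-1%g = (levi g)^-1%g.
Proof.
have levi1 : levi 1%g = 1%g by apply: GLn_mx_inj; exact/esym/scalar_mx_block.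
by apply: (mulgI (levi g)); rewrite -leviM ?in_setT // !mulgV.
Qed.

Lemma levi_inj : ('injm levi)%g.
Proof.
apply/injmP=> g h _ _ /(congr1 GLn_mx) /eq_block_mx[gh _ _ _].
exact: val_inj.
Qed.

Lemma levi_tr g : levi (GLtr g) = GLtr (levi g).
Proof.
by apply: GLn_mx_inj; rewrite [RHS](_ : _ = (levi_mx (GLval g))^T) //
   tr_block_mx !trmx0 trmx1.
Qed.

(** The last block of rcons mu k consists of the indices from m on, so the
    conditions on the entries separate along the block decomposition m + k. *)
Lemma U_rconsP (mu : seq nat) (u : GLn) : sumn mu = m ->
  reflect [/\ dlsubmx (GLn_mx u) = 0, drsubmx (GLn_mx u) = 1%:M
   & forall i j : 'I_m, (reshape_index mu j <= reshape_index mu i)%N ->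
             ulsubmx (GLn_mx u) i j = (i == j)%:R]
  (u \in U_set F (m + k) (rcons mu k)).
Proof.
move=> sum_mu; pose ri i := reshape_index (rcons mu k) i.
have riL (i : 'I_m) : ri (lshift k i) = reshape_index mu i.
  by rewrite /ri reshape_index_rcons sum_mu //= ?ltn_addr // ltn_ord.
have riR (i : 'I_k) : ri (rshift m i) = size mu.
  by rewrite /ri reshape_index_rcons sum_mu //= ?ltn_add2l // ltnNge leq_addr.
have riM (i : 'I_m) : (reshape_index mu i < size mu)%N.
  by rewrite reshape_indexP // sum_mu.
have UP : reflect (forall i j : 'I_(m + k), (ri j <= ri i)%N ->
                     GLn_mx u i j = (i == j)%:R)
                  (u \in U_set F (m + k) (rcons mu k)).
  exact: (U_setP (rcons mu k) u).
apply: (iffP UP) => [uU | [u_dl u_dr u_ul] i j].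
  split=> [||i j ij].
  - apply/matrixP=> i j; rewrite !mxE uU ?eq_rlshift // riL riR.
    exact/ltnW/riM.
  - by apply/matrixP=> i j; rewrite !mxE uU ?eq_rshift // !riR.
  - by rewrite !mxE uU ?eq_lshift // !riL.
rewrite -[GLn_mx u]submxK u_dl u_dr.
case: (split_ordP i) => i' ->; case: (split_ordP j) => j' ->; rewrite ?riL ?riR.
- by move=> ij; rewrite block_mxEul u_ul // eq_lshift.
- by rewrite leqNgt riM.
- by rewrite block_mxEdl mxE eq_rlshift.
by rewrite block_mxEdr mxE eq_rshift.
Qed.

Lemma leviU (mu : seq nat) (g : GLm) : sumn mu = m ->
  (levi g \in U_set F (m + k) (rcons mu k)) = (g \in U_set F m mu).
Proof.
move=> sum_mu; apply/(U_rconsP _ sum_mu)/U_setP => [[_ _] gU i j ij | gU].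
  by rewrite -gU // [GLn_mx _]/(levi_mx _) block_mxKul.
rewrite [GLn_mx _]/(levi_mx _) block_mxKul block_mxKdl block_mxKdr.
by split.
Qed.

Lemma radicalP (u : GLn) :
  reflect (exists b, GLn_mx u = block_mx 1%:M b 0 1%:M)
          (u \in U_set F (m + k) [:: m; k]).
Proof.
have sum_m : sumn [:: m] = m by rewrite /= addn0.
apply: (iffP (@U_rconsP [:: m] u sum_m)) => [[u_dl u_dr u_ul] | [b ->]].
  exists (ursubmx (GLn_mx u)).
  rewrite -{1}[GLn_mx u]submxK u_dl u_dr; congr block_mx; apply/matrixP=> i j.
  rewrite u_ul ?mxE // /reshape_index /=.
  by have /eqP-> : (j.+1 - m == 0)%N by rewrite subn_eq0 ltn_ord.
rewrite block_mxKul block_mxKdl block_mxKdr.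
by split=> // i j _; rewrite mxE.
Qed.

Lemma radicalJ (u : GLn) (g : GLm) :
  u \in U_set F (m + k) [:: m; k] ->
  (u ^ levi g)%g \in U_set F (m + k) [:: m; k].
Proof.
case/radicalP=> b ub; apply/radicalP; exists (invmx (GLval g) *m b).
rewrite conjgE -leviV [LHS](_ : _ =
  levi_mx (invmx (GLval g)) *m (GLn_mx u *m levi_mx (GLval g))) //.
rewrite ub !mulmx_block !(mul0mx, mulmx0, addr0, add0r, mul1mx, mulmx1).
by rewrite mulVmx // (GL_unitmx g).
Qed.

Lemma levi_normal : (levi @* [set: GLm] \subset 'N(Nk))%g.
Proof.
apply/subsetP=> _ /morphimP[g _ _ ->]; rewrite inE.
by apply/subsetP=> _ /imsetP[u uN ->]; exact: radicalJ.
Qed.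

(** Transposition reverses products, so this is [levi_normal] transposed: the
    Levi subgroup is stable under transposition. *)
Lemma levi_normal_op : (levi @* [set: GLm] \subset 'N(Nop))%g.
Proof.
apply/subsetP=> _ /morphimP[g _ _ ->].
rewrite inE; apply/subsetP=> _ /imsetP[v + ->].
rewrite /= !Uop_setE => /imsetP[u uN ->].
have -> : (GLtr u ^ levi g = GLtr (u ^ levi (GLtr g)^-1))%g.
  by rewrite GLtrJ leviV invgK levi_tr GLtrK.
apply: imset_f; exact: radicalJ.
Qed.

Lemma radical_levi_TI (A : {group GLm}) : (Nk :&: levi @* A = 1)%g.
Proof.
apply/trivgP/subsetP=> u /setIP[/radicalP[b ub] /morphimP[g _ _ def_u]].
move: ub; rewrite def_u => /eq_block_mx[g1 _ _ _].
by rewrite (_ : g = 1%g) ?morph1 ?inE //; apply: val_inj.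
Qed.

(** In block form, [a b; 0 1] = [1 b; 0 1] [a 0; 0 1]. *)
Lemma U_rcons_mul (mu : seq nat) : sumn mu = m ->
  (Nk * levi @* U_group F m mu)%g = U_set F (m + k) (rcons mu k).
Proof.
move=> sum_mu; apply/setP=> u.
apply/mulsgP/idP => [[v _ vN /morphimP[g _ gU ->] ->] | uU].
  apply: (@groupM _ (U_group F (m + k) (rcons mu k))); last by rewrite leviU.
  have /radicalP[b vb] := vN; apply/(U_rconsP _ sum_mu).
  rewrite vb block_mxKul block_mxKdl block_mxKdr.
  by split=> // i j _; rewrite mxE.
have /(U_rconsP _ sum_mu)[u_dl u_dr u_ul] := uU.
set a := ulsubmx _ in u_ul.
have ua : GLn_mx u = block_mx a (ursubmx (GLn_mx u)) 0 1%:M.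
  by rewrite -{1}[GLn_mx u]submxK u_dl u_dr.
have a_unit : a \is a GRing.unit.
  rewrite -[_ \is a _]/(a \in unitmx) unitmxE.
  have : GLn_mx u \in unitmx := GL_unitmx u.
  by rewrite ua unitmxE det_ublock det1 mulr1.
pose g : GLm := FinRing.unit _ a_unit.
exists (u * (levi g)^-1)%g (levi g); last by rewrite mulgKV.
  apply/radicalP; exists (ursubmx (GLn_mx u)); rewrite -leviV.
  rewrite [LHS](_ : _ = GLn_mx u *m levi_mx (invmx a)) //.
  rewrite ua !mulmx_block !(mul0mx, mulmx0, addr0, add0r, mul1mx, mulmx1).
  by rewrite block_mxKur mulmxV.
by apply: mem_morphim; rewrite ?in_setT //; apply/U_setP.
Qed.

(** Transposing [U_rcons_mul] puts the Levi factor on the left; it moves back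
    to the right because it normalizes the opposite radical. *)
Lemma Uop_rcons_mul (mu : seq nat) : sumn mu = m ->
  (Nop * levi @* Uop_group F m mu)%g = Uop_set F (m + k) (rcons mu k).
Proof.
move=> sum_mu.
rewrite -(normC (subset_trans (morphimS _ (subsetT _)) levi_normal_op)).
rewrite /= !Uop_setE -U_rcons_mul //.
apply/setP=> v; apply/mulsgP/imsetP.
  case=> _ _ /morphimP[_ _ /imsetP[g gU ->] ->] /imsetP[u uN ->] ->.
  exists (u * levi g)%g; last by rewrite GLtrM -levi_tr.
  by apply: mem_mulg => //; apply: mem_morphim; rewrite ?in_setT.
case=> _ /mulsgP[u _ uN /morphimP[g _ gU ->] ->] ->.
exists (GLtr (levi g)) (GLtr u); rewrite ?GLtrM // ?imset_f //.
by rewrite -levi_tr; apply: mem_morphim; rewrite ?in_setT // imset_f.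
Qed.

(** * Eigenvalues of the Radon transform *)

Lemma radon_eigenvalues_rcons (C : numClosedFieldType) (mu : seq nat) (c : C) :
    sumn mu = m -> c \in radon_eigenvalues C F (m + k) (rcons mu k) ->
  exists a b, [/\ a \in radon_eigenvalues C F (m + k) [:: m; k],
                  b \in radon_eigenvalues C F m mu & c = a * b].
Proof.
move=> sum_mu; rewrite !inE => c_eig.
have sLN (L : {group GLm}) : (levi @* L \subset 'N(Nk))%g.
  exact: subset_trans (morphimS _ (subsetT _)) levi_normal.
have sLM (L : {group GLm}) : (levi @* L \subset 'N(Nop))%g.
  exact: subset_trans (morphimS _ (subsetT _)) levi_normal_op.
have [|a [b [a_eig b_eig ->]]] := radon_of_leigenvalue_mul
   (sLN (U_group F m mu)) (sLM (U_group F m mu))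
   (sLN (Uop_group F m mu)) (sLM (Uop_group F m mu))
   (U := U_group F (m + k) (rcons mu k))
   (U' := Uop_group F (m + k) (rcons mu k))
   (U_rcons_mul sum_mu) (Uop_rcons_mul sum_mu) (radical_levi_TI _) (c := c).
  exact: c_eig.
exists a, b; split=> //; rewrite inE.
exact: (radon_of_leigenvalue_morphim
          (H := U_group F m mu) (K := Uop_group F m mu) levi_inj b_eig).
Qed.

End Levi.

Theorem theorem3p12 (R : realType) (F : finFieldType) (n l : nat)
    (lambda : l.-tuple nat)
    (hl : (2 <= l)%N)
    (hpos : forall i : 'I_l, (0 < tnth lambda i)%N)
    (hsum : (\sum_(i < l) tnth lambda i)%N = n) :
  let lambda_l := last 0%N lambda in
  let lambda' := take l.-1 lambda in
  forall c : R[i],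
    c \in radon_eigenvalues R[i] F n lambda ->
    exists a b : R[i],
      [/\ a \in radon_eigenvalues R[i] F n [:: (n - lambda_l)%N; lambda_l],
          b \in radon_eigenvalues R[i] F (sumn lambda') lambda'
        & c = a * b].
Proof.
move=> lambda_l lambda'.
have def_lambda : tval lambda = rcons lambda' lambda_l.
  rewrite /lambda' /lambda_l; case: (lambda) hl => s /= /eqP <-.
  by case/lastP: s => // s x _; rewrite size_rcons last_rcons -{2}cats1 take_size_cat.
have def_n : n = (sumn lambda' + lambda_l)%N.
  by rewrite -hsum -sumn_rcons -def_lambda sumnE big_tuple.
have n_gt0 : (0 < sumn lambda')%N.
  have l_gt0 : (0 < l)%N by apply: leq_trans hl.
  have l1_gt0 : (0 < l.-1)%N by rewrite -ltnS prednK.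
  have size_lambda' : size lambda' = l.-1 by rewrite size_takel // size_tuple leq_pred.
  have := hpos (Ordinal l_gt0).
  rewrite (tnth_nth 0%N) /= def_lambda nth_rcons size_lambda' l1_gt0.
  by case: (lambda') => //= a s a_gt0; rewrite addn_gt0 a_gt0.
rewrite def_lambda def_n addnK.
case sum_lambda': (sumn lambda') n_gt0 => [//|p] _ c.
exact: radon_eigenvalues_rcons.
Qed.
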